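(* Let $Q=\exists x_1\forall x_2\exists x_3\cdots\forall x_n\,F$ where $n\ge 2$ is even, the quantifiers strictly alternate starting with $\exists$, and $F=F_1\wedge\cdots\wedge F_m$ with $F_i=(l_{i,1}\vee l_{i,2}\vee l_{i,3})$, each literal $l_{i,j}$ being $x_l$ or $\overline{x_l}$ for some $l\in\{1,\dots,n\}$. Construct the graph-game instance $(G,C,s,R)$ as follows. For each $i=1,\dots,n$ add vertices $a_i,b_i,c_i,d_i,e_i,f_i,g_i$ and edges $(a_i,b_i),(a_i,c_i),(b_i,e_i),(c_i,f_i),(e_i,d_i),(f_i,d_i),(d_i,g_i)$; add edges $(g_i,a_{i+1})$ for $i=1,\dots,n-1$; add a vertex $g_0$ and edge $(g_0,a_1)$. Add vertices $x_i,y_i,z_i$ ($i=1,\dots,m$) and $w_{i,j}$ ($i=1,\dots,m$, $j=1,2,3$) with edges $(x_i,y_i),(y_i,z_i),(z_i,w_{i,1}),(w_{i,1},w_{i,2}),(w_{i,2},w_{i,3})$ for all $i$, $(x_i,x_{i+1})$ for $i=1,\dots,m-1$, and $(g_n,x_1)$. Let $C=\{g_0,\dots,g_{n-1}\}\cup\{z_1,\dots,z_m\}$, $s=g_0$, and let $R$ consist of the pairs $(w_{i,j},(b_l,e_l))$ whenever $l_{i,j}=x_l$ and $(w_{i,j},(c_l,f_l))$ whenever $l_{i,j}=\overline{x_l}$. Then the $\exists$-player has a winning strategy in the graph game on $(G,C,s,R)$ if and only if $Q$ is true.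
   Context: The graph game: an instance consists of a finite directed graph $G$, a set $C\subseteq V(G)$, a vertex $s\in C$, and a relation $R\subseteq V(G)\times E(G)$ (''$v$ points to $e$'' if $(v,e)\in R$). At any moment $E(G)$ is the current edge set (edges are deleted during play) and $R^{-1}(E(G))$ is the set of vertices pointing to some edge currently in $E(G)$. The $\exists$-player and $\forall$-player move alternately, $\exists$ first; there is a unique active vertex, initially $s$. A move from active vertex $u$: the current player chooses $v\in C\cup R^{-1}(E(G))$ and a directed path $P$ in the current graph from $u$ to $v$ whose internal vertices all lie outside $C\cup R^{-1}(E(G))$; the edges of $P$ are deleted, $v$ becomes active, and the turn passes. A player who cannot move loses; a player who moves to a vertex of $R^{-1}(E(G))$ wins. *)

(* Defs.v *)
From HB Require Import structures.
From mathcomp Require Import all_boot.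
Set Implicit Arguments. Unset Strict Implicit. Unset Printing Implicit Defensive.

Section Game.
Variable V : finType.
Variable C : {set V}.
Variable R : V -> V * V -> bool.

Definition pointers (E : {set V * V}) : {set V} :=
  [set v | [exists e in E, R v e]].

Definition stops (E : {set V * V}) : {set V} := C :|: pointers E.

(* A directed path u = v_0, v_1, ..., v_k = v (k >= 1) is encoded by    *)
(* u and the list p = [:: v_1; ...; v_k].                               *)
Definition path_edges (u : V) (p : seq V) : {set V * V} :=
  [set e in zip (belast u p) p].

Definition is_move (E : {set V * V}) (u v : V) (p : seq V) : bool :=
  [&& p != [::], last u p == v,
      path (fun x y => (x, y) \in E) u p, uniq (u :: p),
      v \in stops E &
      all (fun x => x \notin stops E) (behead (belast u p))].

(* Win E u : the player whose turn it is, with current edge set E and  *)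
(* active vertex u, has a winning strategy.  She makes a legal move to  *)
(* v along p; either v in R^{-1}(E) (she wins immediately), or every    *)
(* legal reply of the opponent (if none, the opponent loses) does not   *)
(* reach R^{-1} of the then-current graph and leads to a position that  *)
(* is again winning for her.  Every move deletes >= 1 edge, so the game *)
(* is finite and this inductive notion is exactly existence of a        *)
(* winning strategy.                                                    *)
Inductive Win : {set V * V} -> V -> Prop :=
| WinI E u v p :
    is_move E u v p ->
    (v \in pointers E \/
     (forall v' p',
        is_move (E :\: path_edges u p) v v' p' ->
        v' \notin pointers (E :\: path_edges u p) /\
        Win ((E :\: path_edges u p) :\: path_edges v p') v')) ->
    Win E u.

End Game.

(* Variables x_1..x_n are indexed by l : 'I_n (x_{l+1}).  A literal is  *)
(* (l, true) for x_{l+1} and (l, false) for its negation.  Clause i     *)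
(* (i : 'I_m) has literals cl i 0, cl i 1, cl i 2.                      *)

Definition cnf_eval (n m : nat) (cl : 'I_m -> 'I_3 -> 'I_n * bool)
    (asg : nat -> bool) : bool :=
  [forall i : 'I_m, [exists j : 'I_3, asg (val (cl i j).1) == (cl i j).2]].

(* quantifying variables with 0-based indices i, i+1, ..., i+k-1;      *)
(* variable with 0-based index i (i.e. x_{i+1}) is existential iff i   *)
(* is even.                                                            *)
Fixpoint qbf_from (phi : (nat -> bool) -> bool) (k i : nat)
    (asg : nat -> bool) : bool :=
  match k with
  | 0 => phi asg
  | k'.+1 =>
      let ext b := qbf_from phi k' i.+1 (fun j => if j == i then b else asg j) in
      if ~~ odd i then ext true || ext false else ext true && ext false
  end.

Definition qbf_true (n m : nat) (cl : 'I_m -> 'I_3 -> 'I_n * bool) : bool :=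
  qbf_from (cnf_eval cl) n 0 (fun _ => false).

(* The constructed instance.  Vertices:                                *)
(*   inl (inl (i, k))  : gadget of variable x_{i+1}, k = 0..6 for       *)
(*                       a,b,c,d,e,f,g                                 *)
(*   inl (inr tt)      : g_0                                           *)
(*   inr (i, k)        : clause i+1, k = 0..5 for x,y,z,w1,w2,w3        *)
Definition gvtx (n m : nat) : finType :=
  ((('I_n * 'I_7) + unit) + ('I_m * 'I_6))%type.

Section Construction.
Variables n m : nat.

Definition gv (i : 'I_n) (k : nat) : gvtx n m := inl (inl (i, inord k)).
Definition va i := gv i 0.  Definition vb i := gv i 1.
Definition vc i := gv i 2.  Definition vd i := gv i 3.
Definition ve i := gv i 4.  Definition vf i := gv i 5.
Definition vg i := gv i 6.
Definition vg0 : gvtx n m := inl (inr tt).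
Definition cv (i : 'I_m) (k : nat) : gvtx n m := inr (i, inord k).
Definition vx i := cv i 0.  Definition vy i := cv i 1.
Definition vz i := cv i 2.
(* w_{i, j+1} for j : 'I_3 *)
Definition vw i (j : 'I_3) := cv i (3 + val j).

Definition gedges : {set gvtx n m * gvtx n m} :=
  [set e | [exists i : 'I_n,
     [|| e == (va i, vb i), e == (va i, vc i), e == (vb i, ve i),
         e == (vc i, vf i), e == (ve i, vd i), e == (vf i, vd i)
       | e == (vd i, vg i)]]]
  :|: [set e | [exists i : 'I_n, exists j : 'I_n,
                 (val j == (val i).+1) && (e == (vg i, va j))]]
  :|: [set e | [exists i : 'I_n, (val i == 0) && (e == (vg0, va i))]]
  :|: [set e | [exists i : 'I_m,
     [|| e == (vx i, vy i), e == (vy i, vz i), e == (vz i, vw i (inord 0)),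
         e == (vw i (inord 0), vw i (inord 1))
       | e == (vw i (inord 1), vw i (inord 2))]]]
  :|: [set e | [exists i : 'I_m, exists j : 'I_m,
                 (val j == (val i).+1) && (e == (vx i, vx j))]]
  :|: [set e | [exists i : 'I_n, exists j : 'I_m,
                 [&& val i == n.-1, val j == 0 & e == (vg i, vx j)]]].

(* C = {g_0, ..., g_{n-1}} u {z_1, ..., z_m}; gadget i (0-based) has  *)
(* g-vertex g_{i+1}.                                                   *)
Definition gC : {set gvtx n m} :=
  [set vg0]
  :|: [set v | [exists i : 'I_n, (val i < n.-1) && (v == vg i)]]
  :|: [set v | [exists i : 'I_m, v == vz i]].

Definition gR (cl : 'I_m -> 'I_3 -> 'I_n * bool)
    (v : gvtx n m) (e : gvtx n m * gvtx n m) : bool :=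
  [exists i : 'I_m, exists j : 'I_3,
     (v == vw i j) &&
     (e == (if (cl i j).2 then (vb (cl i j).1, ve (cl i j).1)
            else (vc (cl i j).1, vf (cl i j).1)))].

End Construction.

(* Main.v *)
Require Import Defs.
From HB Require Import structures.
From mathcomp Require Import all_boot zify.
Set Implicit Arguments. Unset Strict Implicit. Unset Printing Implicit Defensive.

(* Every edge of the constructed graph strictly increases an explicit rank
   (g_0 < gadget 1 < g_1 < ... < gadget n < g_n < clause 1 < ... < clause m).

   A play is always in a [position]: the graph
   beyond the active vertex g_k is intact, and in each of the first k
   variable gadgets exactly one literal edge survives, recording a truth
   assignment.  From g_k the mover must cross gadget k+1, which amounts to
   choosing x_(k+1); she stops at g_(k+1) if k+1 < n, while the last
   (universal) move continues down the clause chain to a z_j of her choice.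
   From z_j the existential player wins iff some w-vertex of clause j
   points to a surviving edge, i.e. iff clause j is satisfied
   ([clause_win]).  An induction over quantifier pairs ([win_gvert]) then
   matches winning from g_k with the truth of the remaining QBF. *)

Section RankedGame.
Variables (V : finType) (C : {set V}) (R : V -> V * V -> bool).
Variables (E0 : {set V * V}) (rk : V -> nat).
Hypothesis rk_edge : forall u w, (u, w) \in E0 -> rk u < rk w.

Local Notation move := (is_move C R).
Local Notation stop E := (stops C R E).

Lemma path_edges_nil (u : V) : path_edges u [::] = set0.
Proof. by apply/setP=> e; rewrite !inE. Qed.

Lemma path_edges_cons (u w : V) q : path_edges u (w :: q) = (u, w) |: path_edges w q.
Proof. by apply/setP=> e; rewrite !inE. Qed.

Lemma path_edges_cat (u : V) p q :
  path_edges u (p ++ q) = path_edges u p :|: path_edges (last u p) q.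
Proof.
elim: p u => [|w p IH] u /=; first by rewrite path_edges_nil set0U.
by rewrite !path_edges_cons IH setUA.
Qed.

Lemma ranked_path (E : {set V * V}) u p : E \subset E0 ->
  path (fun x y => (x, y) \in E) u p -> path (fun x y => rk x < rk y) u p.
Proof. by move=> sE; apply: sub_path => x y /(subsetP sE) /rk_edge. Qed.

Lemma ranked_path_uniq (E : {set V * V}) u p : E \subset E0 ->
  path (fun x y => (x, y) \in E) u p -> uniq (u :: p).
Proof.
move=> sE /(ranked_path sE) hp.
have: sorted ltn (map rk (u :: p)) by rewrite /= path_map.
by move/(sorted_uniq ltn_trans ltnn)/map_uniq.
Qed.

Lemma path_edges_rank u p e : path (fun x y => rk x < rk y) u p ->
  e \in path_edges u p -> rk u <= rk e.1.
Proof.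
elim: p u => [|w p IH] u; first by rewrite path_edges_nil inE.
rewrite path_edges_cons in_setU1 /= => /andP[huw hp] /orP[/eqP -> //|/(IH _ hp)].
exact/leq_trans/ltnW.
Qed.

Lemma is_move_cons (E : {set V * V}) u v w q : E \subset E0 ->
  move E u v (w :: q) =
  ((u, w) \in E) && (if q is [::] then (w == v) && (v \in stop E)
                     else (w \notin stop E) && move E w v q).
Proof.
move=> sE; rewrite /is_move; case: q => [|y q] /=.
  apply/idP/idP; first by case/and5P=> -> /andP[-> _] _ -> _.
  case/and3P=> huw hwv hv; rewrite huw hwv hv /= !andbT inE.
  by apply/eqP=> e; have := rk_edge (subsetP sE _ huw); rewrite e ltnn.
apply/idP/idP.
  case/and5P=> hl /and3P[huw hwy hp] _ hv /andP[hw ha].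
  rewrite hl huw hwy hp hv hw ha /= ?andbT.
  by apply: (ranked_path_uniq (u := w) (p := y :: q) sE); rewrite /= hwy hp.
case/and3P=> huw hw /and5P[hl /andP[hwy hp] _ hv ha].
rewrite hl huw hwy hp hv hw ha /= ?andbT.
by apply: (ranked_path_uniq (u := u) (p := [:: w, y & q]) sE); rewrite /= huw hwy hp.
Qed.

Lemma move_cons (E : {set V * V}) u w v q : E \subset E0 -> (u, w) \in E ->
  w \notin stop E -> move E w v q -> move E u v (w :: q).
Proof.
move=> sE huw hw hm; rewrite is_move_cons // huw /=.
by case: q hm => [|y q] hm //; rewrite hw.
Qed.

Lemma move_edge (E : {set V * V}) u w : E \subset E0 -> (u, w) \in E ->
  w \in stop E -> move E u w [:: w].
Proof. by move=> sE huw hw; rewrite is_move_cons // huw eqxx hw. Qed.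

Lemma move_behead (E : {set V * V}) u w v q : E \subset E0 ->
  w \notin stop E -> move E u v (w :: q) -> (u, w) \in E /\ move E w v q.
Proof.
move=> sE hw; rewrite is_move_cons // => /andP[-> ].
case: q => [|y q]; last by case/andP.
by case/andP=> /eqP ev hv; rewrite ev hv in hw.
Qed.

Lemma move_forced (E : {set V * V}) u v p w0 : E \subset E0 ->
  w0 \notin stop E -> (forall w, (u, w) \in E0 -> w = w0) -> move E u v p ->
  exists2 p', p = w0 :: p' & move E w0 v p'.
Proof.
move=> sE hs hw; case: p => [|w q] // hm.
have := hm; rewrite is_move_cons // => /andP[/(subsetP sE)/hw ew _]; subst w.
by have [_ h] := move_behead sE hs hm; exists q.
Qed.

Lemma move_rank (E : {set V * V}) u v p : E \subset E0 -> move E u v p ->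
  rk u < rk v /\ forall e, e \in path_edges u p -> rk u <= rk e.1 < rk v.
Proof.
move=> sE; elim: p u => [|w q IH] u //.
rewrite is_move_cons // => /andP[huw].
have ruw := rk_edge (subsetP sE _ huw).
case: q IH => [|y q] IH.
  case/andP=> /eqP <- _; split=> // e.
  by rewrite path_edges_cons path_edges_nil setU0 => /set1P -> /=; rewrite leqnn.
case/andP=> _ /IH [rwv IHe]; split; first exact: ltn_trans rwv.
move=> e; rewrite path_edges_cons in_setU1 => /orP[/eqP -> /=|/IHe /andP[h1 ->]].
  by rewrite leqnn (ltn_trans ruw rwv).
by rewrite andbT (leq_trans (ltnW ruw) h1).
Qed.

Lemma move_end_stop (E : {set V * V}) u v p : move E u v p -> v \in stop E.
Proof. by case/and5P=> _ _ _ _ /andP[]. Qed.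

Lemma move_split (E : {set V * V}) u v w q : E \subset E0 ->
  move E u v (w :: q) -> (u, w) \in E /\ (v = w \/ move E w v q).
Proof.
move=> sE; rewrite is_move_cons //; case: q => [|y q] /andP[-> h]; split=> //.
  by left; case/andP: h => /eqP ->.
by right; case/andP: h.
Qed.

Definition replies_lose (E : {set V * V}) (u : V) : Prop :=
  forall v p, move E u v p ->
    v \notin pointers R E /\ Win C R (E :\: path_edges u p) v.

Lemma winP (E : {set V * V}) u : Win C R E u <-> exists v p, move E u v p /\
  (v \in pointers R E \/ replies_lose (E :\: path_edges u p) v).
Proof.
split; first by case=> E1 u1 v p hm h; exists v, p.
by case=> v [p [hm h]]; apply: WinI hm h.
Qed.

Definition fresh (r : nat) (E : {set V * V}) : Prop :=
  E \subset E0 /\ forall u w, (u, w) \in E0 -> r <= rk u -> (u, w) \in E.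

Lemma fresh_le r r' E : fresh r E -> r <= r' -> fresh r' E.
Proof. by case=> sE h hr; split=> // u w huw hu; apply: h huw (leq_trans hr _). Qed.

Lemma fresh_move r (E : {set V * V}) u v p : fresh r E -> r <= rk u ->
  move E u v p -> fresh (rk v) (E :\: path_edges u p).
Proof.
case=> sE h hru hm; have [ruv hpe] := move_rank sE hm; split.
  exact: subset_trans (subsetDl _ _) sE.
move=> x y hxy hvx; rewrite in_setD h //; last first.
  exact: leq_trans hru (leq_trans (ltnW ruv) hvx).
rewrite andbT; apply/negP=> /hpe /=.
by rewrite ltnNge hvx andbF.
Qed.

End RankedGame.

(* C and R are determined by the move (resp. the game) at every use. *)
Arguments is_move_cons [V C R E0 rk].
Arguments winP [V C R].

Definition upd (a : nat -> bool) (k : nat) (b : bool) : nat -> bool :=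
  fun j => if j == k then b else a j.

Lemma qbf_pair (phi : (nat -> bool) -> bool) d i a (P : bool -> Prop) : ~~ odd i ->
  (forall b, P b <-> forall b', qbf_from phi d i.+2 (upd (upd a i b) i.+1 b')) ->
  (exists b, P b) <-> qbf_from phi d.+2 i a.
Proof.
move=> hi hP; rewrite /= hi; split.
  by case=> -[] /hP h; rewrite !h ?orbT.
by case/orP=> /andP[h1 h2]; [exists true | exists false]; apply/hP; case.
Qed.

(* The constructed instance.  Throughout, 0-based indices are used: the
   gadget of variable x_(i+1) consists of [va i, ..., vg i], its last vertex
   vg i is g_(i+1), and [vg0] is g_0. *)
Section Instance.
Variables (n m : nat) (cl : 'I_m -> 'I_3 -> 'I_n * bool).
Hypotheses (hn : 2 <= n) (hm : 0 < m) (hev : ~~ odd n).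

Local Notation V := (gvtx n m).
Local Notation C := (gC n m).
Local Notation R := (gR cl).
Local Notation E0 := (gedges n m).
Local Notation move := (is_move C R).
Local Notation stop E := (stops C R E).

Definition code (v : V) : nat * nat * nat :=
  match v with
  | inl (inl (i, k)) => (0, val i, val k)
  | inl (inr _) => (1, 0, 0)
  | inr (i, k) => (2, val i, val k)
  end.

Lemma code_inj : injective code.
Proof.
case=> [[[i k]|[]]|[i k]] [[[i' k']|[]]|[i' k']] //= [].
- by move=> /val_inj -> /val_inj ->.
- by move=> /val_inj -> /val_inj ->.
Qed.

Lemma code_gv i k : k < 7 -> code (gv m i k) = (0, val i, k).
Proof. by move=> hk; rewrite /= inordK. Qed.
Lemma code_cv i k : k < 6 -> code (cv n i k) = (2, val i, k).
Proof. by move=> hk; rewrite /= inordK. Qed.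

Lemma code_va i : code (va m i) = (0, val i, 0). Proof. exact: code_gv. Qed.
Lemma code_vb i : code (vb m i) = (0, val i, 1). Proof. exact: code_gv. Qed.
Lemma code_vc i : code (vc m i) = (0, val i, 2). Proof. exact: code_gv. Qed.
Lemma code_vd i : code (vd m i) = (0, val i, 3). Proof. exact: code_gv. Qed.
Lemma code_ve i : code (ve m i) = (0, val i, 4). Proof. exact: code_gv. Qed.
Lemma code_vf i : code (vf m i) = (0, val i, 5). Proof. exact: code_gv. Qed.
Lemma code_vg i : code (vg m i) = (0, val i, 6). Proof. exact: code_gv. Qed.
Lemma code_vg0 : code (vg0 n m) = (1, 0, 0). Proof. by []. Qed.
Lemma code_vx i : code (vx n i) = (2, val i, 0). Proof. exact: code_cv. Qed.
Lemma code_vy i : code (vy n i) = (2, val i, 1). Proof. exact: code_cv. Qed.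
Lemma code_vz i : code (vz n i) = (2, val i, 2). Proof. exact: code_cv. Qed.
Lemma code_vw i j : code (vw n i j) = (2, val i, 3 + val j).
Proof. by apply: code_cv; case: j => [[|[|[|]]]]. Qed.

Definition codeE := (code_va, code_vb, code_vc, code_vd, code_ve, code_vf,
  code_vg, code_vg0, code_vx, code_vy, code_vz, code_vw).

Lemma val_inord3 k : k < 3 -> val (inord k : 'I_3) = k.
Proof. exact: inordK. Qed.

Lemma decode_gadget w i k : code w = (0, i, k) -> k < 7 ->
  exists2 j : 'I_n, val j = i & w = gv m j k.
Proof.
case: w => [[[j kk]|[]]|[j kk]] //= [hj hk] hk7.
by exists j => //; apply: code_inj; rewrite code_gv //= hk.
Qed.

Lemma decode_clause w i k : code w = (2, i, k) -> k < 6 ->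
  exists2 j : 'I_m, val j = i & w = cv n j k.
Proof.
case: w => [[[j kk]|[]]|[j kk]] //= [hj hk] hk6.
by exists j => //; apply: code_inj; rewrite code_cv //= hk.
Qed.

Definition next_code (c c' : nat * nat * nat) : bool :=
  let: (t, i, k) := c in
  match t, k with
  | 0, 0 => (c' == (0, i, 1)) || (c' == (0, i, 2))
  | 0, 1 => c' == (0, i, 4)
  | 0, 2 => c' == (0, i, 5)
  | 0, 4 => c' == (0, i, 3)
  | 0, 5 => c' == (0, i, 3)
  | 0, 3 => c' == (0, i, 6)
  | 0, 6 => if i.+1 < n then c' == (0, i.+1, 0)
            else (i.+1 == n) && (c' == (2, 0, 0))
  | 1, _ => c' == (0, 0, 0)
  | 2, 0 => (c' == (2, i, 1)) || ((i.+1 < m) && (c' == (2, i.+1, 0)))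
  | 2, 1 => c' == (2, i, 2)
  | 2, 2 => c' == (2, i, 3)
  | 2, 3 => c' == (2, i, 4)
  | 2, 4 => c' == (2, i, 5)
  | _, _ => false
  end.

Lemma gedges_next u w : (u, w) \in E0 -> next_code (code u) (code w).
Proof.
rewrite !inE; case/orP => [/orP[/orP[/orP[/orP[H|H]|H]|H]|H]|H].
- by case/existsP: H => i; repeat case/orP; move/eqP=> [-> ->];
    rewrite !codeE /= ?eqxx ?orbT.
- case/existsP: H => i /existsP[j /andP[/eqP hj /eqP[-> ->]]].
  by rewrite !codeE /= -hj ltn_ord eqxx.
- case/existsP: H => i /andP[/eqP hi /eqP[-> ->]].
  by rewrite !codeE /= hi.
- by case/existsP: H => i; repeat case/orP; move/eqP=> [-> ->];
    rewrite !codeE /= ?val_inord3 //= ?eqxx ?orbT.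
- case/existsP: H => i /existsP[j /andP[/eqP hj /eqP[-> ->]]].
  by rewrite !codeE /= -hj ltn_ord eqxx orbT.
- case/existsP: H => i /existsP[j /and3P[/eqP hi /eqP hj /eqP[-> ->]]].
  by rewrite !codeE /= hi hj prednK ?ltnn ?eqxx // (leq_trans _ hn).
Qed.

(* The rank: g_0 < gadget 1 < g_1 < ... < g_n < clause 1 < ... < clause m,
   inside a variable gadget a < b < c < e < f < d < g, inside a clause
   gadget x < y < z < w1 < w2 < w3. *)
Definition rank_code (c : nat * nat * nat) : nat :=
  let: (t, i, k) := c in
  if t is 0 then 7 * i + nth 0 [:: 1; 2; 3; 6; 4; 5; 7] k
  else if t is 1 then 0 else 7 * n + 1 + 6 * i + k.

Definition rk (v : V) : nat := rank_code (code v).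

Lemma next_code_rank c c' : next_code c c' -> rank_code c < rank_code c'.
Proof.
case: c => [[t i] k]; case: t => [|[|[|t]]] //=.
- case: k => [|[|[|[|[|[|[|k]]]]]]] //=;
    try by (move/eqP-> => /=; lia) || (case/orP=> /eqP-> /=; lia).
  by case: ifP => [_ /eqP-> /=|_ /andP[/eqP hi /eqP-> /=]]; lia.
- by move/eqP->.
- case: k => [|[|[|[|[|k]]]]] //=; try by move/eqP-> => /=; lia.
  by case/orP=> [/eqP->|/andP[_ /eqP->]] /=; lia.
Qed.

Lemma rk_edge u w : (u, w) \in E0 -> rk u < rk w.
Proof. by move/gedges_next/next_code_rank. Qed.

Lemma rk_va i : rk (va m i) = 7 * i + 1. Proof. by rewrite /rk codeE. Qed.
Lemma rk_vb i : rk (vb m i) = 7 * i + 2. Proof. by rewrite /rk codeE. Qed.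
Lemma rk_vc i : rk (vc m i) = 7 * i + 3. Proof. by rewrite /rk codeE. Qed.
Lemma rk_vd i : rk (vd m i) = 7 * i + 6. Proof. by rewrite /rk codeE. Qed.
Lemma rk_ve i : rk (ve m i) = 7 * i + 4. Proof. by rewrite /rk codeE. Qed.
Lemma rk_vf i : rk (vf m i) = 7 * i + 5. Proof. by rewrite /rk codeE. Qed.
Lemma rk_vg i : rk (vg m i) = 7 * i + 7. Proof. by rewrite /rk codeE. Qed.
Lemma rk_vx i : rk (vx n i) = 7 * n + 1 + 6 * i.
Proof. by rewrite /rk codeE /= addn0. Qed.
Lemma rk_vy i : rk (vy n i) = 7 * n + 1 + 6 * i + 1. Proof. by rewrite /rk codeE. Qed.
Lemma rk_vz i : rk (vz n i) = 7 * n + 1 + 6 * i + 2. Proof. by rewrite /rk codeE. Qed.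
Lemma rk_vw i j : rk (vw n i j) = 7 * n + 1 + 6 * i + (3 + j).
Proof. by rewrite /rk codeE. Qed.

Definition rkE := (rk_va, rk_vb, rk_vc, rk_vd, rk_ve, rk_vf, rk_vg,
  rk_vx, rk_vy, rk_vz, rk_vw).

Ltac next_tac := move/gedges_next; rewrite !codeE /=.
Ltac code_tac h := apply: code_inj; rewrite h !codeE.

Lemma succ_va i w : (va m i, w) \in E0 -> w = vb m i \/ w = vc m i.
Proof. by next_tac => /orP[/eqP h|/eqP h]; [left|right]; code_tac h. Qed.
Lemma succ_vb i w : (vb m i, w) \in E0 -> w = ve m i.
Proof. by next_tac => /eqP h; code_tac h. Qed.
Lemma succ_vc i w : (vc m i, w) \in E0 -> w = vf m i.
Proof. by next_tac => /eqP h; code_tac h. Qed.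
Lemma succ_ve i w : (ve m i, w) \in E0 -> w = vd m i.
Proof. by next_tac => /eqP h; code_tac h. Qed.
Lemma succ_vf i w : (vf m i, w) \in E0 -> w = vd m i.
Proof. by next_tac => /eqP h; code_tac h. Qed.
Lemma succ_vd i w : (vd m i, w) \in E0 -> w = vg m i.
Proof. by next_tac => /eqP h; code_tac h. Qed.
Lemma succ_vg0 w : (vg0 n m, w) \in E0 -> exists2 j : 'I_n, val j = 0 & w = va m j.
Proof. by next_tac => /eqP h; apply: decode_gadget h _. Qed.
Lemma succ_vg_mid i w : (vg m i, w) \in E0 -> i.+1 < n ->
  exists2 j : 'I_n, val j = i.+1 & w = va m j.
Proof. by next_tac => + hi; rewrite hi => /eqP h; apply: decode_gadget h _. Qed.
Lemma succ_vg_last i w : (vg m i, w) \in E0 -> i.+1 = n ->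
  exists2 j : 'I_m, val j = 0 & w = vx n j.
Proof.
by next_tac => + hi; rewrite hi ltnn => /andP[_ /eqP h]; apply: decode_clause h _.
Qed.
Lemma succ_vx i w : (vx n i, w) \in E0 ->
  w = vy n i \/ exists2 j : 'I_m, val j = i.+1 & w = vx n j.
Proof.
next_tac => /orP[/eqP h|/andP[_ /eqP h]]; first by left; code_tac h.
by right; apply: decode_clause h _.
Qed.
Lemma succ_vy i w : (vy n i, w) \in E0 -> w = vz n i.
Proof. by next_tac => /eqP h; code_tac h. Qed.
Lemma succ_vz i w : (vz n i, w) \in E0 -> w = vw n i (inord 0).
Proof. by next_tac => /eqP h; code_tac h; rewrite val_inord3. Qed.
Lemma succ_vw0 i w : (vw n i (inord 0), w) \in E0 -> w = vw n i (inord 1).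
Proof. by next_tac; rewrite !val_inord3 //= => /eqP h; code_tac h; rewrite val_inord3. Qed.
Lemma succ_vw1 i w : (vw n i (inord 1), w) \in E0 -> w = vw n i (inord 2).
Proof. by next_tac; rewrite !val_inord3 //= => /eqP h; code_tac h; rewrite val_inord3. Qed.
Lemma succ_vw2 i w : (vw n i (inord 2), w) \in E0 -> False.
Proof. by next_tac; rewrite !val_inord3. Qed.

(* The edges of the instance, family by family.  Disjuncts are selected by
   position: letting [eqxx] search for the right one is very slow. *)
Lemma gadget_edge i e :
  [|| e == (va m i, vb m i), e == (va m i, vc m i), e == (vb m i, ve m i),
      e == (vc m i, vf m i), e == (ve m i, vd m i), e == (vf m i, vd m i)
    | e == (vd m i, vg m i)] -> e \in E0.
Proof. by move=> h; rewrite !inE; do 5 (apply/orP; left); apply/existsP; exists i. Qed.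

Lemma clause_edge i e :
  [|| e == (vx n i, vy n i), e == (vy n i, vz n i), e == (vz n i, vw n i (inord 0)),
      e == (vw n i (inord 0), vw n i (inord 1))
    | e == (vw n i (inord 1), vw n i (inord 2))] -> e \in E0.
Proof.
by move=> h; rewrite !inE; do 2 (apply/orP; left); apply/orP; right; apply/existsP; exists i.
Qed.

Lemma e_ab i : (va m i, vb m i) \in E0.
Proof. by apply: gadget_edge; apply/orP; left. Qed.
Lemma e_ac i : (va m i, vc m i) \in E0.
Proof. by apply: gadget_edge; do 1 (apply/orP; right); apply/orP; left. Qed.
Lemma e_be i : (vb m i, ve m i) \in E0.
Proof. by apply: gadget_edge; do 2 (apply/orP; right); apply/orP; left. Qed.
Lemma e_cf i : (vc m i, vf m i) \in E0.
Proof. by apply: gadget_edge; do 3 (apply/orP; right); apply/orP; left. Qed.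
Lemma e_ed i : (ve m i, vd m i) \in E0.
Proof. by apply: gadget_edge; do 4 (apply/orP; right); apply/orP; left. Qed.
Lemma e_fd i : (vf m i, vd m i) \in E0.
Proof. by apply: gadget_edge; do 5 (apply/orP; right); apply/orP; left. Qed.
Lemma e_dg i : (vd m i, vg m i) \in E0.
Proof. by apply: gadget_edge; do 6 (apply/orP; right). Qed.

Lemma e_xy i : (vx n i, vy n i) \in E0.
Proof. by apply: clause_edge; apply/orP; left. Qed.
Lemma e_yz i : (vy n i, vz n i) \in E0.
Proof. by apply: clause_edge; do 1 (apply/orP; right); apply/orP; left. Qed.
Lemma e_zw i : (vz n i, vw n i (inord 0)) \in E0.
Proof. by apply: clause_edge; do 2 (apply/orP; right); apply/orP; left. Qed.
Lemma e_w01 i : (vw n i (inord 0), vw n i (inord 1)) \in E0.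
Proof. by apply: clause_edge; do 3 (apply/orP; right); apply/orP; left. Qed.
Lemma e_w12 i : (vw n i (inord 1), vw n i (inord 2)) \in E0.
Proof. by apply: clause_edge; do 4 (apply/orP; right). Qed.

Lemma e_ga (i j : 'I_n) : val j = i.+1 -> (vg m i, va m j) \in E0.
Proof.
move=> h; rewrite !inE; do 4 (apply/orP; left); apply/orP; right.
by apply/existsP; exists i; apply/existsP; exists j; rewrite h !eqxx.
Qed.
Lemma e_g0a (j : 'I_n) : val j = 0 -> (vg0 n m, va m j) \in E0.
Proof.
move=> h; rewrite !inE; do 3 (apply/orP; left); apply/orP; right.
by apply/existsP; exists j; rewrite h !eqxx.
Qed.
Lemma e_xx (i j : 'I_m) : val j = i.+1 -> (vx n i, vx n j) \in E0.
Proof.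
move=> h; rewrite !inE; apply/orP; left; apply/orP; right.
by apply/existsP; exists i; apply/existsP; exists j; rewrite h !eqxx.
Qed.
Lemma e_gx (i : 'I_n) (j : 'I_m) : val i = n.-1 -> val j = 0 -> (vg m i, vx n j) \in E0.
Proof.
move=> h h'; rewrite !inE; apply/orP; right.
by apply/existsP; exists i; apply/existsP; exists j; rewrite h h' !eqxx.
Qed.

Definition in_C_code (c : nat * nat * nat) : bool :=
  let: (t, i, k) := c in
  [|| t == 1, (t == 0) && (k == 6) && (i < n.-1) | (t == 2) && (k == 2)].

Lemma in_gC v : (v \in C) = in_C_code (code v).
Proof.
apply/idP/idP.
  rewrite !inE; case/orP => [/orP[/eqP->|/existsP[i /andP[hi /eqP->]]]|/existsP[i /eqP->]].
  - by rewrite !codeE.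
  - by rewrite !codeE /= hi.
  - by rewrite !codeE /= ?orbT.
case: v => [[[i k]|[]]|[i k]] /=.
- rewrite orbF => /andP[/eqP hk hi]; rewrite !inE; apply/orP; left; apply/orP; right.
  by apply/existsP; exists i; rewrite hi; apply/eqP/code_inj; rewrite codeE /= hk.
- by rewrite !inE eqxx.
- move/eqP=> hk; rewrite !inE; apply/orP; right; apply/existsP; exists i.
  by apply/eqP/code_inj; rewrite codeE /= hk.
Qed.

(* The edge whose presence makes the literal [lit] true. *)
Definition lit_edge (lit : 'I_n * bool) : V * V :=
  if lit.2 then (vb m lit.1, ve m lit.1) else (vc m lit.1, vf m lit.1).

Lemma pointerP (E : {set V * V}) v : v \in pointers R E ->
  exists i j, v = vw n i j /\ lit_edge (cl i j) \in E.
Proof.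
rewrite inE => /existsP[e /andP[he /existsP[i /existsP[j /andP[/eqP-> /eqP ee]]]]].
by exists i, j; split=> //; rewrite /lit_edge -ee.
Qed.

Lemma pointer_vw (E : {set V * V}) i j :
  (vw n i j \in pointers R E) = (lit_edge (cl i j) \in E).
Proof.
apply/idP/idP.
  case/pointerP=> i' [j' [/(congr1 code)]]; rewrite !codeE => -[/val_inj ei /eqP].
  by rewrite eqn_add2l => /eqP/val_inj ej; rewrite ei ej.
move=> h; rewrite inE; apply/existsP; exists (lit_edge (cl i j)); rewrite h /=.
by apply/existsP; exists i; apply/existsP; exists j; apply/andP; split; apply/eqP.
Qed.

Lemma nonpointer (E : {set V * V}) v :
  ((code v).1.1 != 2) || ((code v).2 < 3) -> v \notin pointers R E.
Proof. by move=> hv; apply/negP=> /pointerP[i [j [ev _]]]; rewrite ev codeE in hv. Qed.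

Lemma nonstop (E : {set V * V}) v : ~~ in_C_code (code v) ->
  ((code v).1.1 != 2) || ((code v).2 < 3) -> v \notin stop E.
Proof. by move=> hC hv; rewrite inE in_gC negb_or hC nonpointer. Qed.

Ltac nonstop_tac := apply: nonstop; rewrite ?codeE //=.

Lemma stop_vw (E : {set V * V}) i j : (vw n i j \in stop E) = (vw n i j \in pointers R E).
Proof. by rewrite inE in_gC codeE. Qed.

Definition ord_n0 : 'I_n := Ordinal (leq_trans (isT : 0 < 2) hn).
Definition ord_m0 : 'I_m := Ordinal hm.
Definition ordn (k : nat) : 'I_n := insubd ord_n0 k.
Definition ordm (k : nat) : 'I_m := insubd ord_m0 k.
Lemma ordnK k : k < n -> val (ordn k) = k.
Proof. by move=> hk; rewrite val_insubd hk. Qed.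
Lemma ordmK k : k < m -> val (ordm k) = k.
Proof. by move=> hk; rewrite val_insubd hk. Qed.

Definition gvert (k : nat) : V := if k is k'.+1 then vg m (ordn k') else vg0 n m.

Lemma rk_gvert k : k <= n -> rk (gvert k) = 7 * k.
Proof. by case: k => [|k] hk //; rewrite /= rk_vg ordnK //; lia. Qed.

Lemma gvert_nonpointer (E : {set V * V}) k : gvert k \notin pointers R E.
Proof. by apply: nonpointer; case: k => [|k]; rewrite /= ?codeE. Qed.

Lemma gvert_stop (E : {set V * V}) k : k.+1 < n -> gvert k.+1 \in stop E.
Proof. by move=> hk; rewrite /stops in_setU in_gC (code_vg (ordn k)) /= ordnK; lia. Qed.

Lemma gvert_last_nonstop (E : {set V * V}) k : k.+1 = n -> gvert k.+1 \notin stop E.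
Proof. by move=> hk; nonstop_tac; rewrite ordnK; lia. Qed.

Lemma succ_gvert k w : k < n -> (gvert k, w) \in E0 -> w = va m (ordn k).
Proof.
case: k => [|k] hk /=.
  by case/succ_vg0 => j hj ->; congr va; apply: val_inj; rewrite ordnK.
move/succ_vg_mid; rewrite ordnK ?hk; last exact: ltnW.
by case=> // j hj ->; congr va; apply: val_inj; rewrite ordnK.
Qed.

Lemma edge_gvert k : k < n -> (gvert k, va m (ordn k)) \in E0.
Proof.
case: k => [|k] hk /=; first by apply: e_g0a; rewrite ordnK.
by apply: e_ga; rewrite !ordnK // (ltnW hk).
Qed.

(* The path g_k -> g_(k+1) through gadget k+1: via c and f if b (deleting
   the edge (c,f) of the negative literal, i.e. setting x_(k+1) true), via
   b and e otherwise. *)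
Definition gadget_path (k : nat) (b : bool) : seq V :=
  [:: va m (ordn k); if b then vc m (ordn k) else vb m (ordn k);
      if b then vf m (ordn k) else ve m (ordn k); vd m (ordn k); gvert k.+1].

Lemma gadget_path_edges k b : k < n ->
  ((vb m (ordn k), ve m (ordn k)) \in path_edges (gvert k) (gadget_path k b)) = ~~ b /\
  ((vc m (ordn k), vf m (ordn k)) \in path_edges (gvert k) (gadget_path k b)) = b.
Proof.
move=> hk; case: b; rewrite /gadget_path /= !path_edges_cons path_edges_nil
  !in_setU1 !in_set0 !xpair_eqE -!(inj_eq code_inj) !codeE;
  case: k hk => [|k] hk; rewrite /= ?codeE /= !xpair_eqE ?inordK //= ?eqxx /= ?andbF ?orbT //=.
Qed.

Definition encodes (k : nat) (a : nat -> bool) (E : {set V * V}) : Prop :=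
  forall l : 'I_n, l < k ->
    ((vb m l, ve m l) \in E) = a l /\ ((vc m l, vf m l) \in E) = ~~ a l.

Definition position (r k : nat) (a : nat -> bool) (E : {set V * V}) : Prop :=
  fresh E0 rk r E /\ encodes k a E.

Definition gadget_tail (E : {set V * V}) k v (q : seq V) : bool :=
  if q is [::] then (gvert k.+1 == v) && (v \in stop E)
  else (gvert k.+1 \notin stop E) && move E (gvert k.+1) v q.

Lemma gadget_nonstop (E : {set V * V}) i j : j < 6 -> gv m i j \notin stop E.
Proof.
move=> hj; apply: nonstop; last by rewrite (code_gv _ (ltnW hj)).
rewrite (code_gv _ (ltnW hj)) //= orbF.
by apply/negP=> /andP[/eqP ej _]; rewrite ej in hj.
Qed.

Lemma gadget_unfold r k a (E : {set V * V}) v p : position r k a E -> k < n ->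
  move E (gvert k) v p ->
  exists b q, p = gadget_path k b ++ q /\ gadget_tail E k v q.
Proof.
move=> [[sE _] _] hk hmv; set i := ordn k.
have ns := @gadget_nonstop E i.
have [p1 -> hm1] := move_forced rk_edge sE (ns 0 isT) (fun w => @succ_gvert k w hk) hmv.
case: p1 hm1 => [|w2 p2] // hm2.
move: (hm2); rewrite (is_move_cons rk_edge) // => /andP[/(subsetP sE)/succ_va[] ew2 _];
  subst w2.
- have [_ hm3] := move_behead rk_edge sE (ns 1 isT) hm2.
  have [p3 -> hm4] := move_forced rk_edge sE (ns 4 isT) (fun w => @succ_vb _ w) hm3.
  have [[|w5 q] -> hm5] := move_forced rk_edge sE (ns 3 isT) (fun w => @succ_ve _ w) hm4 => //.
  move: hm5; rewrite (is_move_cons rk_edge) // => /andP[/(subsetP sE)/succ_vd -> ht].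
  by exists false, q.
- have [_ hm3] := move_behead rk_edge sE (ns 2 isT) hm2.
  have [p3 -> hm4] := move_forced rk_edge sE (ns 5 isT) (fun w => @succ_vc _ w) hm3.
  have [[|w5 q] -> hm5] := move_forced rk_edge sE (ns 3 isT) (fun w => @succ_vf _ w) hm4 => //.
  move: hm5; rewrite (is_move_cons rk_edge) // => /andP[/(subsetP sE)/succ_vd -> ht].
  by exists true, q.
Qed.

Lemma gadget_build r k a (E : {set V * V}) v q b : position r k a E -> r <= 7 * k ->
  k < n -> gadget_tail E k v q -> move E (gvert k) v (gadget_path k b ++ q).
Proof.
move=> [[sE intact] _] hr hk ht; set i := ordn k.
have hi : val i = k by rewrite ordnK.
have keep x y : (x, y) \in E0 -> 7 * k <= rk x -> (x, y) \in E.
  by move=> h h'; apply: intact h (leq_trans hr h').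
have ns := @gadget_nonstop E i.
have tail : move E (vd m i) v (vg m i :: q).
  have hdg : (vd m i, vg m i) \in E by apply: keep (e_dg _) _; rewrite rkE hi; lia.
  case: q ht => [|y q] /=; first by case/andP=> /eqP <- hv; apply: (move_edge rk_edge).
  by case/andP=> hs hmv; apply: (move_cons rk_edge).
have hga : (gvert k, va m i) \in E.
  by apply: keep (edge_gvert hk) _; rewrite (rk_gvert (ltnW hk)).
apply: (move_cons rk_edge sE hga (ns 0 isT)); case: b.
- apply: (move_cons rk_edge sE _ (ns 2 isT)); first by apply: keep (e_ac _) _; rewrite rkE hi; lia.
  apply: (move_cons rk_edge sE _ (ns 5 isT)); first by apply: keep (e_cf _) _; rewrite rkE hi; lia.
  by apply: (move_cons rk_edge sE _ (ns 3 isT) tail); apply: keep (e_fd _) _; rewrite rkE hi; lia.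
- apply: (move_cons rk_edge sE _ (ns 1 isT)); first by apply: keep (e_ab _) _; rewrite rkE hi; lia.
  apply: (move_cons rk_edge sE _ (ns 4 isT)); first by apply: keep (e_be _) _; rewrite rkE hi; lia.
  by apply: (move_cons rk_edge sE _ (ns 3 isT) tail); apply: keep (e_ed _) _; rewrite rkE hi; lia.
Qed.

Lemma gadget_after r k a (E : {set V * V}) v b q : position r k a E ->
  r <= 7 * k -> k < n -> move E (gvert k) v (gadget_path k b ++ q) ->
  position (rk v) k.+1 (upd a k b) (E :\: path_edges (gvert k) (gadget_path k b ++ q)).
Proof.
move=> [hf enc] hr hk hmv; have [sE intact] := hf.
have hrk : r <= rk (gvert k) by rewrite (rk_gvert (ltnW hk)).
split; first exact: (fresh_move rk_edge hf hrk hmv).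
have [_ hpe] := move_rank rk_edge sE hmv.
have low x y : rk x < 7 * k -> (x, y) \notin path_edges (gvert k) (gadget_path k b ++ q).
  move=> hx; apply/negP=> hin; have /andP[h _] := hpe _ hin.
  by move: h; rewrite (rk_gvert (ltnW hk)) leqNgt hx.
move=> l hl; rewrite /upd; case: (ltnP l k) => hlk.
  rewrite !in_setD !low ?rkE; try lia.
  by have [-> ->] := enc l hlk; rewrite (ltn_eqF hlk).
have -> : l = ordn k by apply: val_inj => /=; rewrite ordnK //; lia.
rewrite ordnK // eqxx.
have [hbe hcf] := gadget_path_edges b hk.
case/and4P: hmv => _ _ hp _.
have hq : path (fun x y => rk x < rk y) (vg m (ordn k)) q.
  by move: (ranked_path rk_edge sE hp); rewrite cat_path => /andP[].
have tail x y : rk x < rk (vg m (ordn k)) -> (x, y) \notin path_edges (vg m (ordn k)) q.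
  by move=> hx; apply/negP=> /(path_edges_rank hq) /=; rewrite leqNgt hx.
rewrite !in_setD path_edges_cat !in_setU /= hbe hcf !(negbTE (tail _ _ _)) ?rkE ?ordnK; try lia.
by rewrite !intact ?e_be ?e_cf ?rkE ?ordnK //; try lia; case: (b).
Qed.

Lemma mid_moves r k a (E : {set V * V}) : position r k a E -> r <= 7 * k -> k.+1 < n ->
  forall v p, move E (gvert k) v p <-> exists b, v = gvert k.+1 /\ p = gadget_path k b.
Proof.
move=> hpos hr hk v p; split.
  case/(gadget_unfold hpos (ltnW hk)) => b [[|y q] [-> ht]].
    by case/andP: ht => /eqP <- _; exists b; rewrite cats0.
  by move: ht; rewrite /= gvert_stop.
case=> b [-> ->]; rewrite -[gadget_path k b]cats0.
by apply: gadget_build hpos hr (ltnW hk) _; rewrite /gadget_tail eqxx gvert_stop.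
Qed.

Lemma chain_move_end (E : {set V * V}) v q j : E \subset E0 ->
  move E (vx n j) v q -> exists j', v = vz n j'.
Proof.
move=> sE; elim: q j => [|w q IH] j // hmv.
move: (hmv); rewrite (is_move_cons rk_edge) // => /andP[/(subsetP sE)/succ_vx hw _].
case: hw => [ew|[j' _ ew]]; subst w.
  have nsy : vy n j \notin stop E by nonstop_tac.
  have [_] := move_behead rk_edge sE nsy hmv.
  case: q {IH hmv} => [|w q] //; rewrite (is_move_cons rk_edge) //.
  case/andP=> /(subsetP sE)/succ_vy ->.
  by case: q => [/andP[/eqP <- _]|y q]; [exists j | rewrite inE in_gC codeE].
have nsx : vx n j' \notin stop E by nonstop_tac.
by have [_ /IH] := move_behead rk_edge sE nsx hmv.
Qed.

Lemma chain_move (E : {set V * V}) (i : 'I_m) : fresh E0 rk (7 * n) E ->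
  forall d (j : 'I_m), j + d = i -> exists q, move E (vx n j) (vz n i) q.
Proof.
move=> [sE intact]; elim=> [|d IH] j hj.
  have -> : j = i by apply: val_inj => /=; rewrite -hj addn0.
  exists [:: vy n i; vz n i]; apply: (move_cons rk_edge sE); first 2 last.
  - by apply: (move_edge rk_edge sE); [apply: intact (e_yz _) _; rewrite rkE; lia
                                      | rewrite inE in_gC codeE].
  - by apply: intact (e_xy _) _; rewrite rkE; lia.
  - by nonstop_tac.
have hj1 : j.+1 < m by have := ltn_ord i; lia.
have [q hq] := IH (ordm j.+1) (ltac:(by rewrite ordmK //; lia)).
exists (vx n (ordm j.+1) :: q); apply: (move_cons rk_edge sE _ _ hq).
  by apply: intact (e_xx (ordmK hj1)) _; rewrite rkE; lia.
by nonstop_tac.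
Qed.

Lemma last_moves_end r k a (E : {set V * V}) v p : position r k a E -> k.+1 = n ->
  move E (gvert k) v p -> exists b q j, p = gadget_path k b ++ q /\ v = vz n j.
Proof.
move=> hpos hk hmv; have [[sE _] _] := hpos.
have [b [[|y q] [-> /= ht]]] := gadget_unfold hpos (ltac:(lia)) hmv.
  by case/andP: ht => /eqP ev; rewrite -ev (negbTE (gvert_last_nonstop _ hk)).
exists b, (y :: q); case/andP: ht => _ hm1; move: (hm1).
rewrite (is_move_cons rk_edge) // => /andP[/(subsetP sE) hy _].
have [j _ ey] := succ_vg_last hy (ltac:(by rewrite ordnK; lia)); subst y.
have nsx : vx n j \notin stop E by nonstop_tac.
have [_ /(chain_move_end sE)[j' ->]] := move_behead rk_edge sE nsx hm1.
by exists j'.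
Qed.

Lemma last_move r k a (E : {set V * V}) (j : 'I_m) b : position r k a E ->
  r <= 7 * k -> k.+1 = n -> exists q, move E (gvert k) (vz n j) (gadget_path k b ++ q).
Proof.
move=> hpos hr hk; have hk' : k < n by lia.
have [[sE intact] _] := hpos.
have hf : fresh E0 rk (7 * n) E by apply: fresh_le hpos.1 _; lia.
have [q hq] := chain_move hf (add0n j : ord_m0 + j = j).
exists (vx n ord_m0 :: q); apply: (gadget_build b hpos hr hk').
rewrite /gadget_tail gvert_last_nonstop //=; apply: (move_cons rk_edge sE _ _ hq).
  apply: intact; first by apply: e_gx => /=; rewrite ?ordnK //; lia.
  by rewrite rkE ordnK //; lia.
by nonstop_tac.
Qed.

Lemma pointer_literal r a (E : {set V * V}) j t : position r n a E ->
  (vw n j t \in pointers R E) = (a (cl j t).1 == (cl j t).2).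
Proof.
move=> [_ enc]; rewrite pointer_vw /lit_edge.
have [hb hc] := enc _ (ltn_ord (cl j t).1).
by case: (cl j t).2; rewrite ?hb ?hc ?eqb_id ?eqbF_neg.
Qed.

Lemma clause_move_end (E : {set V * V}) j v p : E \subset E0 ->
  move E (vz n j) v p -> exists t, v = vw n j t.
Proof.
move=> sE; case: p => [|w0 q0] // /(move_split rk_edge sE) [/(subsetP sE)/succ_vz ->].
case=> [->|]; first by exists (inord 0).
case: q0 => [|w1 q1] // /(move_split rk_edge sE) [/(subsetP sE)/succ_vw0 ->].
case=> [->|]; first by exists (inord 1).
case: q1 => [|w2 q2] // /(move_split rk_edge sE) [/(subsetP sE)/succ_vw1 ->].
case=> [->|]; first by exists (inord 2).
by case: q2 => [|w3 q3] // /(move_split rk_edge sE) [/(subsetP sE)/succ_vw2].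
Qed.

Lemma clause_win r a (E : {set V * V}) j : position r n a E -> r <= rk (vz n j) ->
  Win C R E (vz n j) <-> [exists t : 'I_3, a (cl j t).1 == (cl j t).2].
Proof.
move=> hpos hr; have [[sE intact] _] := hpos.
have keep x y : (x, y) \in E0 -> rk (vz n j) <= rk x -> (x, y) \in E.
  by move=> h h'; apply: intact h (leq_trans hr h').
split.
  case/winP=> v [p [hmv _]]; have [t ev] := clause_move_end sE hmv.
  apply/existsP; exists t; rewrite -(pointer_literal _ _ hpos) -stop_vw -ev.
  exact: move_end_stop hmv.
case/existsP=> t; rewrite -(pointer_literal _ _ hpos) => ht.
suff [v [p [hmv hv]]] : exists v p, move E (vz n j) v p /\ v \in pointers R E.
  by apply/winP; exists v, p; split=> //; left.
have e0 : (vz n j, vw n j (inord 0)) \in E by apply: keep (e_zw _) _.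
have e1 : (vw n j (inord 0), vw n j (inord 1)) \in E.
  by apply: keep (e_w01 _) _; rewrite !rkE; lia.
have e2 : (vw n j (inord 1), vw n j (inord 2)) \in E.
  by apply: keep (e_w12 _) _; rewrite !rkE; lia.
case h0: (vw n j (inord 0) \in pointers R E).
  by exists (vw n j (inord 0)), [:: vw n j (inord 0)]; rewrite (move_edge rk_edge) // stop_vw.
have n0 : vw n j (inord 0) \notin stop E by rewrite stop_vw h0.
case h1: (vw n j (inord 1) \in pointers R E).
  exists (vw n j (inord 1)), [:: vw n j (inord 0); vw n j (inord 1)].
  split=> //; apply: (move_cons rk_edge sE e0 n0).
  by apply: (move_edge rk_edge sE e1); rewrite stop_vw.
have n1 : vw n j (inord 1) \notin stop E by rewrite stop_vw h1.
have h2 : vw n j (inord 2) \in pointers R E.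
  by move: ht; rewrite -(inord_val t); case: t => [[|[|[|t]]] ?] //=; rewrite ?h0 ?h1.
exists (vw n j (inord 2)), [:: vw n j (inord 0); vw n j (inord 1); vw n j (inord 2)].
split=> //; apply: (move_cons rk_edge sE e0 n0); apply: (move_cons rk_edge sE e1 n1).
by apply: (move_edge rk_edge sE e2); rewrite stop_vw.
Qed.

Local Notation replies_lose := (replies_lose C R).

Lemma win_exists_step k a (E : {set V * V}) : position (7 * k) k a E -> k.+1 < n ->
  Win C R E (gvert k) <->
  exists b, replies_lose (E :\: path_edges (gvert k) (gadget_path k b)) (gvert k.+1).
Proof.
move=> hpos hk; rewrite winP; split.
  case=> v [p [/(mid_moves hpos (leqnn _) hk) [b [-> ->]] [hptr|hrep]]].
    by rewrite (negbTE (gvert_nonpointer _ _)) in hptr.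
  by exists b.
case=> b hrep; exists (gvert k.+1), (gadget_path k b); split; last by right.
by apply/(mid_moves hpos (leqnn _) hk); exists b.
Qed.

Lemma position_mid k a (E : {set V * V}) b : position (7 * k) k a E -> k.+1 < n ->
  position (7 * k.+1) k.+1 (upd a k b) (E :\: path_edges (gvert k) (gadget_path k b)).
Proof.
move=> hpos hk.
have hmv : move E (gvert k) (gvert k.+1) (gadget_path k b ++ [::]).
  by rewrite cats0; apply/(mid_moves hpos (leqnn _) hk); exists b.
by have := gadget_after hpos (leqnn _) (ltnW hk) hmv; rewrite cats0 (rk_gvert (ltnW hk)).
Qed.

Lemma replies_lose_mid k a (E : {set V * V}) : position (7 * k) k a E -> k.+1 < n ->
  replies_lose E (gvert k) <->
  forall b, Win C R (E :\: path_edges (gvert k) (gadget_path k b)) (gvert k.+1).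
Proof.
move=> hpos hk; split=> [hrep b | hwin v p].
  have hmv : move E (gvert k) (gvert k.+1) (gadget_path k b).
    by apply/(mid_moves hpos (leqnn _) hk); exists b.
  by have [_] := hrep _ _ hmv.
case/(mid_moves hpos (leqnn _) hk) => b [-> ->].
by split; [exact: gvert_nonpointer | exact: hwin].
Qed.

Lemma replies_lose_last k a (E : {set V * V}) : position (7 * k) k a E -> k.+1 = n ->
  replies_lose E (gvert k) <-> forall b, cnf_eval cl (upd a k b).
Proof.
move=> hpos hk; split=> [hrep b | hsat v p hmv].
  apply/forallP=> j; have [q hq] := last_move j b hpos (leqnn _) hk.
  have [_ hw] := hrep _ _ hq.
  have := gadget_after hpos (leqnn _) (ltac:(lia)) hq; rewrite hk => hpos'.
  by move/(clause_win hpos' (leqnn _)): hw.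
have [b [q [j [ep ev]]]] := last_moves_end hpos hk hmv; subst p v.
split; first by apply: nonpointer; rewrite codeE.
have := gadget_after hpos (leqnn _) (ltac:(lia)) hmv; rewrite hk => hpos'.
by apply/(clause_win hpos' (leqnn _)); move/forallP: (hsat b) => /(_ j).
Qed.

Lemma win_gvert j : forall k a (E : {set V * V}), k + j.+1.*2 = n ->
  position (7 * k) k a E ->
  Win C R E (gvert k) <-> qbf_from (cnf_eval cl) j.+1.*2 k a.
Proof.
elim: j => [|j IH] k a E hkn hpos.
all: have hk1 : k.+1 < n by lia.
all: have even_k : ~~ odd k by move: hev; rewrite -hkn oddD odd_double addbF.
all: rewrite (win_exists_step hpos hk1) doubleS; apply: qbf_pair => // b.
all: have hpos1 := position_mid b hpos hk1.
- exact: (replies_lose_last hpos1 (ltac:(lia))).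
- rewrite (replies_lose_mid hpos1 (ltac:(lia))); have hk2 : k.+2 < n by lia.
  by split=> h b'; apply/(IH _ _ _ _ (position_mid b' hpos1 hk2)) => //; lia.
Qed.

End Instance.

Theorem mainTheorem2 (n m : nat) (cl : 'I_m -> 'I_3 -> 'I_n * bool)
    (hn : 2 <= n) (hev : ~~ odd n) (hm : 0 < m) :
  Win (gC n m) (gR cl) (gedges n m) (vg0 n m) <-> qbf_true cl.
Proof.
have hpos : position (7 * 0) 0 (fun _ => false) (gedges n m).
  by split=> //; split=> //; apply: subxx.
have hj : (n./2).-1.+1.*2 = n by rewrite prednK ?even_halfK // half_gt0.
have -> : qbf_true cl = qbf_from (cnf_eval cl) (n./2).-1.+1.*2 0 (fun _ => false).
  by rewrite hj.
by apply: (win_gvert cl hn hm hev _ hpos); rewrite add0n.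
Qed.
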